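(* Consider second-price auctions with prescreening and $m\ge2$ potential bidders, and let $R^{\mathrm{SP}}(n;F,m)$ be the expected revenue when $n\in\{2,\dots,m\}$ bidders are admitted using predictor $F$. (i) For every predictor $F$, $R^{\mathrm{SP}}(n;F,m)$ is (weakly) increasing in $n\in\{2,\dots,m\}$; consequently it is optimal to admit all bidders ($n=m$). (ii) For every fixed $n\in\{2,\dots,m\}$, the revenue loss $R^{\mathrm{SP}}(m;F,m)-R^{\mathrm{SP}}(n;F,m)$ from admitting fewer bidders is (weakly) decreasing in the prediction accuracy: if $F$ is more accurate than $\tilde F$, the loss under $F$ is at most the loss under $\tilde F$. Moreover, under the perfect predictor there is no revenue loss: $R^{\mathrm{SP}}(n;F,m)$ takes the same value for every $n\in\{2,\dots,m\}$.
   Context: Model. There are $m\ge2$ risk-neutral potential bidders. The valuation–signal pairs $(V_i,S_i)\in[0,1]^2$ are independent across bidders with common joint CDF $F$ (the ''predictor''), whose marginal CDFs $F_1$ (valuations) and $F_2$ (signals) have strictly positive densities $f_1,f_2$ on $[0,1]$. Standing assumption on every predictor: $\mathbb E[V_i\mid S_i=s]$ is non-decreasing in $s$. Bidder $i$ observes only $V_i$; only the seller observes signals. The seller commits ex ante to a number $n\in\{2,\dots,m\}$ and admits the $n$ bidders with the highest $\mathbb E[V_i\mid S_i=s_i]$, which under the standing assumption is the ranking by signals (the $n$ bidders with the highest signals are admitted). A single item is then auctioned among the admitted bidders. Equivalently, the vector of admitted bidders' valuations has joint density $g(v;n,F)=\binom mn\psi(v;n,F)\prod_{j=1}^nf_1(v_j)$,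 where $\psi(v;n,F)=\int_0^1\prod_{k=1}^n[1-F_{2\mid1}(x\mid v_k)]\,d(F_2(x)^{m-n})$ for $n<m$ ($\psi\equiv1$ for $n=m$) and $F_{2\mid1}(s\mid v)=\Pr(S_i\le s\mid V_i=v)$. Second-price auction: the highest bidder wins and pays the second-highest bid; others pay nothing. Bidders bid truthfully (a dominant strategy), so $R^{\mathrm{SP}}(n;F,m)$ is the expected second-highest admitted valuation. Accuracy: for predictors $F,\tilde F$ with the same marginals ($F_1=\tilde F_1$, $F_2=\tilde F_2$), $F$ is more accurate than $\tilde F$ if $F(v,s)\ge\tilde F(v,s)$ for all $(v,s)\in[0,1]^2$ (positive quadrant dependence order). Perfect predictor: $F(v,s)=\min\{F_1(v),F_2(s)\}$. *)

(* Defs.v *)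
From HB Require Import structures.
From mathcomp Require Import all_boot all_order all_algebra.
From mathcomp Require Import all_classical all_reals all_analysis.
Set Implicit Arguments.
Unset Strict Implicit.
Unset Printing Implicit Defensive.
Import Order.TTheory GRing.Theory Num.Theory.
Import numFieldNormedType.Exports.
Local Open Scope classical_set_scope.
Local Open Scope ring_scope.

Section iid.
Context d (T : measurableType d).

Definition tcons n (x : T * n.-tuple T) : n.+1.-tuple T := cons_tuple x.1 x.2.

Lemma measurable_tcons n : measurable_fun [set: T * n.-tuple T] (@tcons n).
Proof. exact: (measurable_cons measurable_fst measurable_snd). Qed.

HB.instance Definition _ n := isMeasurableFun.Build _ _ _ _ (@tcons n)
  (@measurable_tcons n).

Context (R : realType) (mu : probability T R).

(* The n-fold product of mu, as the law of (x_0, ..., x_{n-1}) with i.i.d.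
   components of law mu; iid_law_rectangle below characterizes it. *)
Fixpoint iid_law n : probability (n.-tuple T) R :=
  match n with
  | 0%N => \d_ (nil_tuple T)
  | n'.+1 => distribution (mu \x iid_law n')%E (@tcons n')
  end.

Lemma iid_law_rectangle n (A : 'I_n -> set T) :
  (forall i, measurable (A i)) ->
  iid_law n [set w | forall i, A i (tnth w i)] = (\prod_(i < n) mu (A i))%E.
Proof.
elim: n A => [|n IHn] A mA.
  by rewrite big_ord0 /= diracE mem_set// => -[].
rewrite big_ord_recl -IHn//= /distribution /pushforward -product_measure1E//.
  congr product_measure1; apply/seteqP; split => -[x w] /=.
    move=> h; split=> [|i]; first by have := h ord0; rewrite tnth0.
    by have := h (lift ord0 i); rewrite tnthS.
  move=> [h0 hS] i; have [->|i0] := eqVneq i ord0; first by rewrite tnth0.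
  have [j ->] : exists j, i = lift ord0 j.
    by case: (unliftP ord0 i) i0 => [j ->|->]; [exists j|rewrite eqxx].
  by rewrite tnthS.
rewrite (_ : [set _ | _] =
    \bigcap_(i in [set: 'I_n]) ((fun w => tnth w i) @^-1` A (lift ord0 i))).
  apply: fin_bigcap_measurable => // i _.
  by rewrite -[X in measurable X]setTI; exact: measurable_tnth.
apply/seteqP; split => w h i; [move=> _|]; first exact: (h i).
exact: (h i Logic.I).
Qed.

End iid.

Section predictors.
Context (R : realType).
Local Open Scope ereal_scope.

(* A predictor is given by the joint law mu of a pair (V, S), the first
   component being the valuation and the second one the signal. *)
Implicit Type mu : probability (R * R)%type R.

Definition jcdf mu (v s : R) : \bar R := mu (`]-oo, v] `*` `]-oo, s]).

Definition cdf1 mu (v : R) : \bar R := mu (`]-oo, v] `*` setT).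

Definition cdf2 mu (s : R) : \bar R := mu (setT `*` `]-oo, s]).

Definition has_positive_density (G : R -> \bar R) : Prop :=
  exists f : R -> R,
    [/\ measurable_fun `[(0 : R)%R, 1%R] f,
        (forall x, (0 <= x <= 1)%R -> (0 < f x)%R) &
        (forall x, (0 <= x <= 1)%R ->
          G x = \int[lebesgue_measure]_(t in `[0%R, x]) (f t)%:E)].

(* s |-> e s is a version of E[V | S = s]. *)
Definition is_cond_exp mu (e : R -> R) : Prop :=
  [/\ measurable_fun setT e,
      mu.-integrable setT (fun z => (e z.2)%:E) &
      (forall B : set R, measurable B ->
        \int[mu]_(z in setT `*` B) (e z.2)%:E
        = \int[mu]_(z in setT `*` B) (z.1)%:E)].

(* As conditional expectations are defined up to null sets, monotonicity of
   E[V | S = s] in s means that some version is monotone. *)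
Definition is_predictor mu : Prop :=
  [/\ mu (`[0%R, 1%R] `*` `[0%R, 1%R]) = 1,
      has_positive_density (cdf1 mu),
      has_positive_density (cdf2 mu) &
      exists2 e : R -> R, is_cond_exp mu e &
        (forall s t, (0 <= s)%R -> (s <= t)%R -> (t <= 1)%R -> (e s <= e t)%R)].

Definition more_accurate mu mu' : Prop :=
  [/\ (forall v, (0 <= v <= 1)%R -> cdf1 mu v = cdf1 mu' v),
      (forall s, (0 <= s <= 1)%R -> cdf2 mu s = cdf2 mu' s) &
      (forall v s, (0 <= v <= 1)%R -> (0 <= s <= 1)%R ->
        jcdf mu' v s <= jcdf mu v s)].

Definition is_perfect mu : Prop :=
  forall v s, (0 <= v <= 1)%R -> (0 <= s <= 1)%R ->
    jcdf mu v s = Order.min (cdf1 mu v) (cdf2 mu s).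

End predictors.

Section auction.
Context (R : realType) (m : nat).

Definition valuation (w : m.-tuple (R * R)) (i : 'I_m) : R := (tnth w i).1.

Definition signal (w : m.-tuple (R * R)) (i : 'I_m) : R := (tnth w i).2.

(* Ties between signals, which have probability zero under a predictor, are
   broken by the index, so that exactly n bidders are admitted if n <= m. *)
Definition outranks (w : m.-tuple (R * R)) (j i : 'I_m) : bool :=
  (signal w i < signal w j) || ((signal w i == signal w j) && (j < i)%N).

Definition admitted (n : nat) (w : m.-tuple (R * R)) : {set 'I_m} :=
  [set i | (#|[set j | outranks w j i]| < n)%N]%SET.

(* Counted with multiplicity: equal highest valuations give that value. *)
Definition second_highest (w : m.-tuple (R * R)) (A : {set 'I_m}) : R :=
  nth 0 (sort >=%R [seq valuation w i | i <- enum A]) 1.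

End auction.

(* Under truthful bidding the price paid is the second-highest valuation among
   the admitted bidders. *)
Definition revenue_SP (R : realType) (n : nat) (mu : probability (R * R)%type R)
    (m : nat) : \bar R :=
  'E_(iid_law mu m) [fun w => second_highest w (admitted n w)].

Definition revenue_loss (R : realType) (n : nat)
    (mu : probability (R * R)%type R) (m : nat) : \bar R :=
  (revenue_SP m mu m - revenue_SP n mu m)%E.

(* Main.v *)
(* The expected price is the integral over t >= 0 of the probability of the
   event E(n, t) that at least two admitted valuations exceed t.
   (i) E(n, t) increases with n.
   (ii) Fix all bidders but one.  Whether that bidder is admitted depends only
   on his signal, through a cutoff, and if he is admitted (resp. rejected) then
   the other admitted bidders do not depend on his type.  So the section of
   E(n, t) is an upper set of valuations above the cutoff and everything or
   nothing below it, and its probability increases with the quadrant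
   probabilities P(V > v, S > s).  Switching the components of the i.i.d. law
   one by one from F' to F gives the comparison for every n; for n = m there is
   no cutoff and only the common marginal of the valuations matters.
   Under the perfect predictor valuations and signals are almost surely
   concordant and signals distinct, so that an unadmitted bidder with valuation
   above t is outbid by the n >= 2 admitted ones: E(n, t) and E(m, t) agree up
   to a null set. *)
From HB Require Import structures.
Require Import Defs.
From mathcomp Require Import all_boot all_order all_algebra.
From mathcomp Require Import all_classical all_reals all_analysis.
From mathcomp Require Import measurable_realfun.
Set Implicit Arguments.
Unset Strict Implicit.
Unset Printing Implicit Defensive.
Import Order.TTheory GRing.Theory Num.Theory.
Import numFieldNormedType.Exports.
Local Open Scope classical_set_scope.
Local Open Scope ring_scope.

(** * Ranking by signals, admission, and the second-highest valuation *)

Section ranking.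
Context (R : realType) (m : nat).
Implicit Types (w : m.-tuple (R * R)) (i j k : 'I_m) (A : {set 'I_m}).

Lemma outranks_irr w i : outranks w i i = false.
Proof. by rewrite /outranks ltxx eqxx ltnn. Qed.

Lemma outranks_trans w : transitive (outranks w).
Proof.
move=> j i k /orP[ij|/andP[/eqP ij ji]] /orP[jk|/andP[/eqP jk kj]];
  rewrite /outranks.
- by rewrite (lt_trans jk ij).
- by rewrite jk ij.
- by rewrite -ij jk.
- by rewrite jk ij eqxx (ltn_trans ji kj) orbT.
Qed.

Lemma outranks_total w i j : i != j -> ~~ outranks w j i -> outranks w i j.
Proof.
rewrite /outranks negb_or -leNgt => ij /andP[+ ji].
rewrite le_eqVlt => /orP[/eqP sji|->//]; move: ji.
rewrite sji eqxx /= -leqNgt leq_eqVlt (inj_eq val_inj) (negbTE ij) /= => ->.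
by rewrite orbT.
Qed.

Definition rank w i : nat := #|[set j | outranks w j i]%SET|.

Lemma in_admitted n w i : (i \in admitted n w) = (rank w i < n)%N.
Proof. by rewrite inE. Qed.

Lemma ltn_rank w i j : outranks w i j -> (rank w i < rank w j)%N.
Proof.
move=> ij; apply/proper_card/properP; split.
  by apply/fintype.subsetP => k; rewrite !inE => /outranks_trans; exact.
by exists i; rewrite inE // outranks_irr.
Qed.

Lemma rank_ltm w i : (rank w i < m)%N.
Proof.
rewrite -[X in (_ < X)%N]card_ord -cardsT; apply/proper_card/properP; split.
  exact: finset.subsetT.
by exists i; rewrite inE // outranks_irr.
Qed.

Lemma rank_inj w : injective (rank w).
Proof.
move=> i j; apply: contra_eq => ij.
have [/ltn_rank|/(outranks_total ij)/ltn_rank] := boolP (outranks w j i).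
  by rewrite neq_ltn => ->; rewrite orbT.
by rewrite neq_ltn => ->.
Qed.

(** Ranks are pairwise distinct and below [m], so they are a permutation of 0, ..., m - 1, and
    exactly [n] of them lie below [n]. *)
Lemma card_admitted n w : (n <= m)%N -> #|admitted n w| = n.
Proof.
move=> nm; pose f i := Ordinal (rank_ltm w i).
have f_inj : injective f by move=> i j [] /rank_inj.
transitivity #|f @^-1: [set k : 'I_m | (k < n)%N]%SET|.
  by apply: eq_card => i; rewrite in_admitted !inE.
rewrite card_preimset// -sum1_card; under eq_bigl do rewrite inE.
by rewrite (big_ord_narrow nm) sum1_card card_ord.
Qed.

Lemma admitted_all w : admitted m w = [set: 'I_m]%SET.
Proof. by apply/setP => i; rewrite in_admitted rank_ltm inE. Qed.

Lemma unadmitted_outranked n w i k :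
  i \notin admitted n w -> k \in admitted n w -> outranks w k i.
Proof.
rewrite !in_admitted -leqNgt => ni kn.
have ki : k != i by apply: contraTneq kn => ->; rewrite -leqNgt.
apply: outranks_total => //; apply/negP => /ltn_rank.
by rewrite ltnNge (leq_trans (ltnW kn) ni).
Qed.

(** The rank [j] would have if [i] were absent. For [j] other than [i] it does not involve the type
    of [i]. *)
Definition rank_among w i j : nat :=
  #|[set k | (k != i) && outranks w k j]%SET|.

Lemma rank_rank_among w i j :
  rank w j = (outranks w i j + rank_among w i j)%N.
Proof.
rewrite /rank (cardsD1 i) inE; congr (_ + _)%N.
by apply: eq_card => k; rewrite !inE.
Qed.

Lemma mem_admitted_in n w i j : i \in admitted n w -> j != i ->
  (j \in admitted n w) = ((rank_among w i j).+1 < n)%N.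
Proof.
rewrite !in_admitted => ni ji; rewrite (rank_rank_among w i j).
have [ij|ij] := boolP (outranks w i j); first by rewrite add1n.
rewrite add0n.
have ji' : outranks w j i by apply: outranks_total.
apply/idP/idP => [_|/ltnW//]; apply: leq_ltn_trans ni.
rewrite /rank (cardsD1 j) inE ji' add1n ltnS; apply/subset_leq_card.
apply/fintype.subsetP => k; rewrite !inE => /andP[ki kj].
rewrite (outranks_trans kj ji') andbT.
by apply: contraTneq kj => ->; rewrite outranks_irr.
Qed.

(** A rejected [i] takes no slot. If [i] outranks [j], the [n] or more bidders above [i] are also
    above [j], so both sides are false. *)
Lemma mem_admitted_notin n w i j : i \notin admitted n w -> j != i ->
  (j \in admitted n w) = (rank_among w i j < n)%N.
Proof.
rewrite !in_admitted -leqNgt => ni ji; rewrite (rank_rank_among w i j).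
have [ij|ij] := boolP (outranks w i j); last by rewrite add0n.
have {}ni : (n <= rank_among w i j)%N.
  rewrite (leq_trans ni)//; apply/subset_leq_card/fintype.subsetP => k.
  rewrite !inE => ki; rewrite (outranks_trans ki ij) andbT.
  by apply: contraTneq ki => ->; rewrite outranks_irr.
by rewrite add1n ltnNge leqW//= ltnNge ni.
Qed.

Section one_bidder_changes.
Variables (w w' : m.-tuple (R * R)) (i : 'I_m).
Hypothesis ww' : forall j, j != i -> tnth w j = tnth w' j.

Let sww' j : j != i -> signal w j = signal w' j.
Proof. by move=> ji; rewrite /signal ww'. Qed.

(** Once the status of [i] is known, the two criteria above decide every other bidder through
    [rank_among], which ignores the type of [i]. *)
Lemma eq_admitted n : (i \in admitted n w) = (i \in admitted n w') ->
  admitted n w = admitted n w'.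
Proof.
move=> iE; apply/setP => j; have [->//|ji] := eqVneq j i.
have rE : rank_among w i j = rank_among w' i j.
  apply: eq_card => k; rewrite !inE; case: eqVneq => //= ki.
  by rewrite /outranks !sww'.
have [iw|iw] := boolP (i \in admitted n w); have := iw; rewrite iE => iw'.
  by rewrite (mem_admitted_in iw ji) (mem_admitted_in iw' ji) rE.
by rewrite (mem_admitted_notin iw ji) (mem_admitted_notin iw' ji) rE.
Qed.

Lemma admitted_signal_le n : signal w i <= signal w' i ->
  i \in admitted n w -> i \in admitted n w'.
Proof.
move=> sle; rewrite !in_admitted; apply: leq_ltn_trans.
apply/subset_leq_card/fintype.subsetP => j; rewrite !inE.
have [->|ji] := eqVneq j i; first by rewrite outranks_irr.
rewrite /outranks (sww' ji) => /orP[/(le_lt_trans sle) -> //|/andP[/eqP <- ->]].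
by rewrite andbT orbC -le_eqVlt.
Qed.

End one_bidder_changes.

Definition num_above w A (t : R) : nat :=
  #|[set i in A | t < valuation w i]%SET|.

Lemma sorted_nth1_gt (s : seq R) t : sorted >=%R s -> (1 < size s)%N ->
  (t < nth 0 s 1) = (1 < count (fun x => (t < x)%R) s)%N.
Proof.
case: s => [//|a [//|b s]] /= /andP[ba ps] _.
have [tb|bt] := ltP t b; first by rewrite (lt_le_trans tb ba).
(* When [b <= t], sortedness keeps all of [s] at or below [b], so only the head can exceed [t]. *)
rewrite (_ : count _ s = 0)%N; first by rewrite !addn0; case: ltP.
apply/eqP; rewrite eqn0Ngt -has_count -all_predC; apply/allP => x xs /=.
move: ps; rewrite path_sortedE; last by move=> ? ? ? /[swap]; exact: le_trans.
by move=> /andP[/allP/(_ _ xs) xb _]; rewrite -leNgt (le_trans xb bt).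
Qed.

(** With at least two members, the default value of [nth] is never read. Equal valuations are
    counted separately on both sides. *)
Lemma second_highest_gt w A t : (1 < #|A|)%N ->
  (t < second_highest w A) = (1 < num_above w A t)%N.
Proof.
move=> A1; rewrite /second_highest sorted_nth1_gt; last 2 first.
- by apply: sort_sorted => x y; exact: ge_total.
- by rewrite size_sort size_map -cardE.
congr (_ < _)%N; rewrite /num_above cardE count_sort count_map -size_filter.
rewrite /enum_mem -filter_predI; congr size; apply: eq_filter => i /=.
by rewrite !inE andbC.
Qed.

End ranking.

(** * One-coordinate sections of events under the i.i.d. law *)

Section iid_law_sections.
Context d (T : measurableType d) (R : realType).
Local Open Scope ereal_scope.

Definition tsubst n (w : n.-tuple T) (i : 'I_n) (x : T) : n.-tuple T :=
  [tuple if j == i then x else tnth w j | j < n].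

Lemma tnth_tsubst_id n (w : n.-tuple T) i x : tnth (tsubst w i x) i = x.
Proof. by rewrite tnth_mktuple eqxx. Qed.

Lemma tnth_tsubst n (w : n.-tuple T) i j x :
  j != i -> tnth (tsubst w i x) j = tnth w j.
Proof. by rewrite tnth_mktuple => /negbTE ->. Qed.

Lemma measurable_tsubst_section n (w : n.-tuple T) i (E : set (n.-tuple T)) :
  measurable E -> measurable [set x | E (tsubst w i x)].
Proof.
move=> mE; rewrite -[X in measurable X]setTI.
have : measurable_fun [set: T] (tsubst w i); last by apply.
apply/measurable_fun_tnthP => j; have [->|ji] := eqVneq j i.
  by apply: eq_measurable_fun (@measurable_id _ _ setT) => x _ /=;
    rewrite tnth_tsubst_id.
by apply: eq_measurable_fun (measurable_cst (tnth w j)) => x _ /=;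
  rewrite tnth_tsubst.
Qed.

Lemma tsubst_tcons0 n x y (w : n.-tuple T) :
  tsubst (tcons (y, w)) ord0 x = tcons (x, w).
Proof.
apply: eq_from_tnth => j; rewrite tnth_mktuple.
case: (unliftP ord0 j) => [k ->|->]; last by rewrite eqxx tnth0.
by rewrite eq_sym (negbTE (neq_lift _ _)) !tnthS.
Qed.

Lemma tsubst_tconsS n x y (w : n.-tuple T) i :
  tsubst (tcons (y, w)) (lift ord0 i) x = tcons (y, tsubst w i x).
Proof.
apply: eq_from_tnth => j; rewrite tnth_mktuple.
case: (unliftP ord0 j) => [k ->|->]; last first.
  by rewrite (negbTE (neq_lift _ _)) !tnth0.
by rewrite (inj_eq lift_inj) !tnthS tnth_mktuple.
Qed.

Implicit Types P Q : probability T R.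

Let measurable_tcons_preimage n (E : set (n.+1.-tuple T)) :
  measurable E -> measurable (@tcons _ T n @^-1` E).
Proof.
by move=> mE; rewrite -[X in measurable X]setTI; exact: measurable_tcons.
Qed.

Lemma xsection_tcons n (E : set (n.+1.-tuple T)) x :
  xsection (@tcons _ T n @^-1` E) x = [set w | E (tcons (x, w))].
Proof. by apply/seteqP; split => w; rewrite /xsection /= inE. Qed.

Lemma ysection_tcons n (E : set (n.+1.-tuple T)) w :
  ysection (@tcons _ T n @^-1` E) w = [set x | E (tcons (x, w))].
Proof. by apply/seteqP; split => x; rewrite /ysection /= inE. Qed.

Lemma iid_lawS P n (E : set (n.+1.-tuple T)) :
  iid_law P n.+1 E = \int[P]_x iid_law P n [set w | E (tcons (x, w))].
Proof. by apply: eq_integral => x _ /=; rewrite xsection_tcons. Qed.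

(** Tonelli for the mixed law with head [Q] and i.i.d. tail [P], the intermediate law when passing
    from [Q] to [P]. *)
Lemma integral_section_swap P Q n (E : set (n.+1.-tuple T)) : measurable E ->
  \int[Q]_x iid_law P n [set w | E (tcons (x, w))] =
  \int[iid_law P n]_w Q [set x | E (tcons (x, w))].
Proof.
move=> /measurable_tcons_preimage mE.
have := indic_fubini_tonelli Q (iid_law P n) mE.
rewrite indic_fubini_tonelli_FE// indic_fubini_tonelli_GE// => FG.
under eq_integral do rewrite -xsection_tcons.
by under [RHS]eq_integral do rewrite -ysection_tcons.
Qed.

Lemma measurable_fun_iid_section P n (E : set (n.+1.-tuple T)) :
  measurable E ->
  measurable_fun [set: T] (fun x => iid_law P n [set w | E (tcons (x, w))]).
Proof.
move=> /measurable_tcons_preimage mE; under eq_fun do rewrite -xsection_tcons.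
exact: measurable_fun_xsection.
Qed.

Lemma measurable_fun_tcons_section Q n (E : set (n.+1.-tuple T)) :
  measurable E ->
  measurable_fun [set: n.-tuple T] (fun w => Q [set x | E (tcons (x, w))]).
Proof.
move=> /measurable_tcons_preimage mE; under eq_fun do rewrite -ysection_tcons.
exact: measurable_fun_ysection.
Qed.

Lemma measurable_tcons_section n (E : set (n.+1.-tuple T)) x :
  measurable E -> measurable [set w | E (tcons (x, w))].
Proof.
move=> /measurable_tcons_preimage/(measurable_xsection x).
by rewrite xsection_tcons.
Qed.

(** A head section is a [tsubst] section as soon as some [y] can fill the head; the first
    alternative handles the case of no such [y]. *)
Lemma tcons_section_tsubst P n (E : set (n.+1.-tuple T)) (w : n.-tuple T) :
  P [set x | E (tcons (x, w))] = 0 \/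
  exists y, [set x | E (tcons (x, w))] =
            [set x | E (tsubst (tcons (y, w)) ord0 x)].
Proof.
have [[y _]|T0] := pselect (exists y : T, True).
  by right; exists y; under [RHS]eq_set do rewrite tsubst_tcons0.
left; rewrite (_ : [set x | _] = set0) ?measure0//.
by apply/seteqP; split => x // _; apply: T0; exists x.
Qed.

(* The components are switched from [Q] to [P] one at a time. *)
Lemma le_iid_law P Q n (E : set (n.-tuple T)) : measurable E ->
  (forall w i, Q [set x | E (tsubst w i x)] <= P [set x | E (tsubst w i x)]) ->
  iid_law Q n E <= iid_law P n E.
Proof.
elim: n E => [//|n IHn] E mE QP; rewrite !iid_lawS.
(* Here the head still has law [Q] while the tail already has law [P]. *)
apply: (@le_trans _ _ (\int[Q]_x iid_law P n [set w | E (tcons (x, w))])).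
  apply: ge0_le_integral => //; try exact: measurable_fun_iid_section.
  move=> x _; apply: IHn => [|w i]; first exact: measurable_tcons_section.
  have := QP (tcons (x, w)) (lift ord0 i).
  by under eq_set do rewrite tsubst_tconsS.
rewrite !integral_section_swap//; apply: ge0_le_integral => //.
- exact: measurable_fun_tcons_section.
- exact: measurable_fun_tcons_section.
by move=> w _; have [->|[y ->]] := tcons_section_tsubst Q E w.
Qed.

(** By Tonelli, coordinate [i] can be integrated out first. *)
Lemma iid_law0 P n (E : set (n.-tuple T)) i : measurable E ->
  (forall w, P [set x | E (tsubst w i x)] = 0) -> iid_law P n E = 0.
Proof.
elim: n E i => [E []//|n IHn] E i mE E0; rewrite iid_lawS.
have [j|] := unliftP ord0 i => ij; last first.
  rewrite integral_section_swap//; apply: integral0_eq => w _.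
  by have [|[y ->]] := tcons_section_tsubst P E w; rewrite -?ij.
apply: integral0_eq => x _; apply: (IHn _ j).
  exact: measurable_tcons_section.
move=> w; have := E0 (tcons (x, w)); rewrite ij.
by under eq_set do rewrite tsubst_tconsS.
Qed.

End iid_law_sections.

(** * Marginals of a predictor: absence of atoms, and lower sets *)

Section projections.
Context d1 d2 (T1 : measurableType d1) (T2 : measurableType d2).

HB.instance Definition _ :=
  isMeasurableFun.Build _ _ (T1 * T2)%type T1 fst measurable_fst.

HB.instance Definition _ :=
  isMeasurableFun.Build _ _ (T1 * T2)%type T2 snd measurable_snd.

End projections.

Section predictor_marginals.
Context (R : realType).
Local Open Scope ereal_scope.
Notation I01 := (`[0%R, 1%R]%classic : set R).

(** Inside the unit interval, the mass of [a] is at most [G a - G x] for every [x] in [0, a[, and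
    this vanishes as [x] tends to [a] because an integral is continuous in its upper bound. At
    [a = 0], [G 0] is an integral over a point. *)
Lemma positive_density_atomless (nu : probability R R) (G : R -> \bar R)
    (a : R) :
  nu I01 = 1 -> has_positive_density G ->
  (forall x : R, (0 <= x <= 1)%R -> nu `]-oo, x]%classic = G x) ->
  nu [set a] = 0.
Proof.
move=> nu1 [f [mf f0 Gf]] nuG.
have [/andP[a0 a1]|a01] := boolP (0 <= a <= 1)%R; last first.
  have nuC : nu (~` I01) = 0 by rewrite probability_setC// nu1 subee.
  apply: (subset_measure0 _ _ _ nuC) => //; first exact: measurableC.
  by move=> x /= ->; rewrite in_itv/=; exact/negP.
have sub01 (x y : R) : (0 <= x)%R -> (y <= 1)%R -> `[x, y] `<=` I01.
  by move=> x0 y1; apply: subset_itv; rewrite bnd_simp.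
have nua_fin : G a < +oo.
  by rewrite -nuG ?a0// -ge0_fin_numE// fin_num_measure.
(* By positivity, the integral of the norm of [f] is [G a], a probability and hence finite. *)
have intf : lebesgue_measure.-integrable `[0%R, a] (EFin \o f).
  apply/integrableP; split.
    by apply/measurable_EFinP; exact: (measurable_funS _ (sub01 _ _ _ a1)).
  rewrite [ltLHS](_ : _ = G a)// Gf ?a0//; apply: eq_integral => x /=.
  rewrite inE/= in_itv/= => /andP[x0 xa].
  by rewrite gtr0_norm// f0// x0 (le_trans xa).
have Gfine x : (0 <= x <= a)%R ->
    G x = (parameterized_integral lebesgue_measure 0 x f)%:E.
  move=> /andP[x0 xa]; rewrite /parameterized_integral /Rintegral fineK.
    by rewrite Gf// x0 (le_trans xa).
  apply: integrable_fin_num => //; apply: integrableS intf => //.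
  by apply: subset_itv; rewrite bnd_simp.
move: a0; rewrite le_eqVlt => /predU1P[a0|a0].
  have nua : nu `]-oo, a]%classic = 0.
    by rewrite nuG -?a0 ?lexx ?ler01// Gf ?lexx ?ler01// set_itv1 integral_set1.
  by apply: (subset_measure0 _ _ _ nua) => // x /= ->; rewrite in_itv/=.
apply/eqP; rewrite eq_le measure_ge0 andbT; apply/lee_addgt0Pr => e e0.
rewrite add0e.
have /cvgrPdist_le/(_ e e0) := parameterized_integral_cvg_at_left a0 intf.
move=> near_a; near a^'- => x.
have x0 : (0 <= x)%R by near: x; exact: nbhs_left_ge.
have xa : (x < a)%R by near: x; exact: nbhs_left_lt.
have : (`|parameterized_integral lebesgue_measure 0 a f -
          parameterized_integral lebesgue_measure 0 x f| <= e)%R by near: x.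
move=> /ler_normlW Gaxe.
apply: (@le_trans _ _ (nu (`]-oo, a] `\` `]-oo, x])%classic)).
  apply: le_measure; rewrite ?inE//; first exact: measurableD.
  move=> _ /= ->; rewrite !in_itv/= lexx; split=> //.
  by apply/negP; rewrite -ltNge.
rewrite measureD//; last first.
  by rewrite -ge0_fin_numE// fin_num_measure.
rewrite setIidr; last by apply: subset_itvl; rewrite bnd_simp ltW.
apply: (@le_trans _ _ (G a - G x)).
  by rewrite -!nuG ?(ltW a0)// ?x0 ?(le_trans (ltW xa)).
by rewrite !Gfine ?x0 ?(ltW a0) ?(ltW xa) ?lexx// -EFinB lee_fin.
Unshelve. all: by end_near. Qed.

(** The threshold is the supremum of [D] within the unit interval, or 0 if [D] misses it. Membership
    of [a] itself is left open, which atomless marginals make harmless. *)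
Lemma down_closed_threshold (D : set R) :
  (forall x y, (x <= y)%R -> D y -> D x) ->
  exists2 a, (0 <= a <= 1)%R &
    forall x, (0 <= x <= 1)%R -> x != a -> (D x <-> (x <= a)%R).
Proof.
move=> Dle; pose S := [set x | (0 <= x <= 1)%R /\ D x].
have [[x0 Sx0]|S0] := pselect (S !=set0); last first.
  exists 0%R => [|x /andP[x0 x1] xneq0]; first by rewrite lexx ler01.
  split=> [Dx|x_le0]; first by case: S0; exists x; rewrite /S/= x0 x1.
  by move: xneq0; rewrite eq_le x_le0 x0.
have S1 : ubound S 1%R by move=> y [/andP[]].
have supS : has_sup S by split; [exists x0|exists 1%R].
exists (sup S).
  case: (Sx0) => /andP[x00 x01] _; apply/andP; split.
    exact: (le_trans x00 (ub_le_sup supS.2 Sx0)).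
  by apply: ge_sup => //; exists x0.
move=> x x01 xsup; split=> [Dx|]; first exact: (ub_le_sup supS.2).
rewrite le_eqVlt (negbTE xsup)/= => /(sup_gt supS.1)[y [_ Dy] xy].
exact: Dle (ltW xy) Dy.
Qed.

Lemma down_closed_measurable (D : set R) :
  (forall x y, (x <= y)%R -> D y -> D x) -> measurable D.
Proof.
move=> Dle; apply: is_interval_measurable => x y _ Dy z /andP[_ zy].
exact: Dle zy Dy.
Qed.

Lemma eq_measure_off_null d (T : measurableType d) (mu : probability T R)
    (A B N : set T) :
  measurable A -> measurable B -> measurable N -> mu N = 0 ->
  (forall x, ~ N x -> (A x <-> B x)) -> mu A = mu B.
Proof.
move=> mA mB mN N0 AB; rewrite -(measureU0 mA mN N0) -(measureU0 mB mN N0).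
congr (mu _); apply/seteqP; split => x [Hx|]; try by right.
  by have [|/AB ABx] := pselect (N x); [right|left; apply/ABx].
by have [|/AB ABx] := pselect (N x); [right|left; apply/ABx].
Qed.

Implicit Types mu F : probability (R * R)%type R.

Lemma predictor_fst_atomless mu (a : R) :
  is_predictor mu -> mu ([set a] `*` setT) = 0.
Proof.
case=> mu1 dens _ _.
pose nu := distribution mu (fst : {mfun (R * R)%type >-> R}).
have nuE A : nu A = mu (A `*` setT) by rewrite setXT.
have nu1 : nu I01 = 1.
  rewrite nuE; apply/eqP; rewrite eq_le probability_le1; last first.
    exact: measurableX.
  by rewrite -mu1 le_measure ?inE//; [exact: measurableX..|move=> [x y] []].
rewrite -nuE; apply: (@positive_density_atomless nu _ a nu1 dens) => x _.
exact: nuE.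
Qed.

Lemma predictor_snd_atomless mu (a : R) :
  is_predictor mu -> mu (setT `*` [set a]) = 0.
Proof.
case=> mu1 _ dens _.
pose nu := distribution mu (snd : {mfun (R * R)%type >-> R}).
have nuE A : nu A = mu (setT `*` A) by rewrite setTX.
have nu1 : nu I01 = 1.
  rewrite nuE; apply/eqP; rewrite eq_le probability_le1; last first.
    exact: measurableX.
  by rewrite -mu1 le_measure ?inE//; [exact: measurableX..|move=> [x y] []].
rewrite -nuE; apply: (@positive_density_atomless nu _ a nu1 dens) => x _.
exact: nuE.
Qed.

Lemma predictor_null mu (a b : R) : is_predictor mu ->
  measurable (~` (I01 `*` I01) `|` ([set a] `*` setT `|` setT `*` [set b])) /\
  mu (~` (I01 `*` I01) `|` ([set a] `*` setT `|` setT `*` [set b])) = 0.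
Proof.
move=> pmu.
have mI : measurable (~` (I01 `*` I01)).
  by apply: measurableC; exact: measurableX.
have m1 : measurable ([set a] `*` [set: R]) by exact: measurableX.
have m2 : measurable ([set: R] `*` [set b]) by exact: measurableX.
have mI0 : mu (~` (I01 `*` I01)) = 0.
  rewrite probability_setC; last exact: measurableX.
  by case: pmu => -> *; rewrite subee.
split; first by apply: measurableU => //; exact: measurableU.
apply: null_set_setU => //; first exact: measurableU.
by apply: null_set_setU => //;
  [exact: predictor_fst_atomless|exact: predictor_snd_atomless].
Qed.

(** The thresholds are chosen before [mu]: the same [a] and [b] serve two predictors, so comparing
    their masses reduces to comparing their CDFs at one point. *)
Lemma predictor_down_closed (D1 D2 : set R) :
  (forall x y, (x <= y)%R -> D1 y -> D1 x) ->
  (forall x y, (x <= y)%R -> D2 y -> D2 x) ->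
  exists a b, [/\ (0 <= a <= 1)%R, (0 <= b <= 1)%R & forall mu,
    is_predictor mu -> [/\ mu (D1 `*` setT) = cdf1 mu a,
      mu (setT `*` D2) = cdf2 mu b & mu (D1 `*` D2) = jcdf mu a b]].
Proof.
move=> D1le D2le.
have [a a01 D1a] := down_closed_threshold D1le.
have [b b01 D2b] := down_closed_threshold D2le.
have mD1 := down_closed_measurable D1le.
have mD2 := down_closed_measurable D2le.
exists a, b; split => // mu pmu; have [mN N0] := predictor_null a b pmu.
have off x :
    ~ (~` (I01 `*` I01) `|` ([set a] `*` setT `|` setT `*` [set b])) x ->
    (D1 x.1 <-> (x.1 <= a)%R) /\ (D2 x.2 <-> (x.2 <= b)%R).
  move=> /not_orP[/contrapT[/= x1 x2] /not_orP[xa xb]]; split.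
    by apply: D1a; [rewrite in_itv in x1|apply/eqP => xa'; apply: xa].
  by apply: D2b; [rewrite in_itv in x2|apply/eqP => xb'; apply: xb].
split; apply: (eq_measure_off_null _ _ mN N0); try exact: measurableX.
- by move=> x /off[] /=; rewrite in_itv/=; tauto.
- by move=> x /off[] /=; rewrite in_itv/=; tauto.
- by move=> x /off[] /=; rewrite !in_itv/=; tauto.
Qed.

End predictor_marginals.

(** * Comparing two predictors on the type of a single bidder *)

Section one_bidder.
Context (R : realType).
Local Open Scope ereal_scope.
Implicit Types mu : probability (R * R)%type R.

(* The complement of [Q] is [D1 x U], possibly together with [setT x ~` U], for
   a lower set [D1]; as [~` U] is a lower set too, the two laws can only differ
   on it through the quadrant probability of [D1 x ~` U]. *)
Lemma le_more_accurate (F F' : probability (R * R)%type R) (U : set R)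
    (Q : set (R * R)) :
  is_predictor F -> is_predictor F' -> more_accurate F F' -> measurable Q ->
  (forall s s', (s <= s')%R -> U s -> U s') ->
  (forall v v' s s', U s -> U s' -> (v <= v')%R -> Q (v, s) -> Q (v', s')) ->
  (forall v v' s s', ~ U s -> ~ U s' -> Q (v, s) -> Q (v', s')) ->
  F' Q <= F Q.
Proof.
move=> pF pF' [eq1 eq2 le12] mQ Ule QU QUC.
pose D1 := [set v | exists2 s, U s & ~ Q (v, s)].
have D1le x y : (x <= y)%R -> D1 y -> D1 x.
  by move=> xy [s Us Qs]; exists s => // /(QU _ _ _ _ Us Us xy).
have D2le x y : (x <= y)%R -> (~` U) y -> (~` U) x.
  by move=> xy /= + /(Ule _ _ xy).
have mD1 := down_closed_measurable D1le.
have mD2 := down_closed_measurable D2le.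
have [a [b [a01 b01 ab]]] := predictor_down_closed D1le D2le.
have DUE mu : is_predictor mu ->
    mu (D1 `*` setT `\` D1 `*` ~` U) = cdf1 mu a - jcdf mu a b.
  move=> /ab[<- _ <-]; rewrite measureD; try exact: measurableX.
    by rewrite setIidr// => -[x y] [].
  by rewrite -ge0_fin_numE// fin_num_measure//; exact: measurableX.
have QUE v s : U s -> Q (v, s) <-> ~ D1 v.
  move=> Us; split=> [Qvs [s' Us']|D1v]; first by apply; exact: QU Qvs.
  by apply: contrapT => Qvs; apply: D1v; exists s.
(* The first marginals agree, and the more accurate [F] gives at least as much mass to the
   subtracted quadrant. *)
have DU : F (D1 `*` setT `\` D1 `*` ~` U) <= F' (D1 `*` setT `\` D1 `*` ~` U).
  by rewrite !DUE// eq1// leeB// le12.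
suff : F (~` Q) <= F' (~` Q).
  by move=> FQ; rewrite -[Q]setCK ![_ (~` ~` Q)]probability_setC ?leeB//;
    exact: measurableC.
(* Outside [U], the event [Q] is everything (first case) or nothing (second case). *)
have [[[v s] /= Us Qvs]|C] := pselect (exists2 z : R * R, ~ U z.2 & Q z).
  rewrite (_ : ~` Q = D1 `*` setT `\` D1 `*` ~` U)//.
  apply/seteqP; split => -[v' s'] /=.
    have [Us'|Us'] := pselect (U s'); last by case; exact: QUC Qvs.
    by move=> /(contra_not (QUE v' s' Us').2)/contrapT D1v; split=> // -[].
  move=> [[D1v _] H]; have Us' : U s' by apply: contrapT => Us'; apply: H.
  by move/(QUE v' s' Us').
have -> : ~` Q = (D1 `*` setT `\` D1 `*` ~` U) `|` (setT `*` ~` U).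
  apply/seteqP; split => -[v' s'] /=.
    have [Us'|Us'] := pselect (U s'); last by right.
    move=> /(contra_not (QUE v' s' Us').2)/contrapT D1v; left.
    by split=> // -[].
  move=> [[[D1v _] H]|[_ Us'] Qs']; last by apply: C; exists (v', s').
  have Us' : U s' by apply: contrapT => Us'; apply: H.
  by move/(QUE v' s' Us').
have mA : measurable (D1 `*` setT `\` D1 `*` ~` U).
  by apply: measurableD; exact: measurableX.
have mB : measurable ([set: R] `*` ~` U) by exact: measurableX.
have dis : [disjoint D1 `*` setT `\` D1 `*` ~` U & [set: R] `*` ~` U].
  by apply/disj_setPS => -[x y] [] [[D1x _]] H [_ /= Uy]; apply: H.
have DC : F (setT `*` ~` U) <= F' (setT `*` ~` U).
  by have [_ -> _] := ab F pF; have [_ -> _] := ab F' pF'; rewrite eq2.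
by rewrite !measureU//; try exact/disj_set2P; exact: leeD.
Qed.

(** Taking [v = v'] shows that [Q] ignores the signal, so only the valuation marginal matters; the
    signal 0 in [D1] is an arbitrary choice. *)
Lemma eq_same_marginal (F F' : probability (R * R)%type R) (Q : set (R * R)) :
  is_predictor F -> is_predictor F' -> more_accurate F F' -> measurable Q ->
  (forall v v' s s', (v <= v')%R -> Q (v, s) -> Q (v', s')) ->
  F' Q = F Q.
Proof.
move=> pF pF' [eq1 eq2 le12] mQ Qle.
pose D1 := [set v | ~ Q (v, 0%R)].
have D1le x y : (x <= y)%R -> D1 y -> D1 x.
  by move=> xy Qy Qx; apply: Qy; apply: Qle Qx.
have [a [b [a01 b01 ab]]] := predictor_down_closed D1le D1le.
rewrite -[Q]setCK (_ : ~` Q = D1 `*` setT); last first.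
  apply/seteqP; split => -[v s] /=.
    by move=> H; split=> //; apply: contra_not H; exact: Qle.
  by move=> [H _]; apply: contra_not H; exact: Qle.
have mD : measurable (D1 `*` [set: R]).
  by apply: measurableX => //; exact: down_closed_measurable.
rewrite !probability_setC//.
by have [-> _ _] := ab F pF; have [-> _ _] := ab F' pF'; rewrite eq1.
Qed.

End one_bidder.

Section finitely_many_tests.
Context d (T : measurableType d).

(** The event is a finite union, over the acceptable outcomes [J], of finite intersections of tests
    or their complements. *)
Lemma measurable_finite_tests (K : finType) (b : K -> T -> bool)
    (Q : {set K} -> bool) :
  (forall k, measurable [set w | b k w]) ->
  measurable [set w | Q [set k | b k w]%SET].
Proof.
move=> mb.
rewrite (_ : [set w | _] = \bigcup_(J in [set J : {set K} | Q J])
    \bigcap_(k in [set: K]) [set w | b k w = (k \in J)]).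
  apply: fin_bigcup_measurable => // J _.
  apply: fin_bigcap_measurable => // k _.
  case: (k \in J); first exact: mb.
  rewrite (_ : mkset _ = ~` [set w | b k w]); first exact/measurableC/mb.
  by apply/seteqP; split => w /=; [move=> ->|move/negP/negbTE].
apply/seteqP; split => w /=.
  by move=> QJ; exists [set k | b k w]%SET => // k _ /=; rewrite inE.
move=> [J QJ bJ]; suff -> : [set k | b k w]%SET = J by [].
by apply/setP => k; rewrite inE; exact: bJ.
Qed.

End finitely_many_tests.

Section price_event.
Context (R : realType) (m : nat).
Implicit Types (n : nat) (t : R) (w : m.-tuple (R * R)).

(** The event written E(n, t) in the overview. *)
Definition two_above n t : set (m.-tuple (R * R)) :=
  [set w | (1 < num_above w (admitted n w) t)%N].

Lemma measurable_valuation (i : 'I_m) :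
  measurable_fun [set: m.-tuple (R * R)%type] (fun w => valuation w i).
Proof. exact: measurableT_comp measurable_fst (measurable_tnth i). Qed.

Lemma measurable_signal (i : 'I_m) :
  measurable_fun [set: m.-tuple (R * R)%type] (fun w => signal w i).
Proof. exact: measurableT_comp measurable_snd (measurable_tnth i). Qed.

Lemma measurable_outranks (i j : 'I_m) :
  measurable [set w : m.-tuple (R * R)%type | outranks w i j].
Proof.
have mle := measurable_fun_ltr (measurable_signal j) (measurable_signal i).
have meq := measurable_fun_eqr (measurable_signal j) (measurable_signal i).
rewrite -[X in measurable X]setTI.
rewrite (_ : [set w | _] = (fun w => outranks w i j) @^-1` [set true])//.
apply: measurable_or => //; apply: measurable_and => //.
Qed.

Lemma measurable_two_above n t : measurable (two_above n t).
Proof.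
(* One finite index type carries both kinds of tests: [Some j] for comparisons of signals, [None]
   for valuations against [t]. *)
pose b (k : option 'I_m * 'I_m) (w : m.-tuple (R * R)%type) :=
  if k.1 is Some j then outranks w j k.2 else (t < valuation w k.2)%R.
pose Q (J : {set option 'I_m * 'I_m}) :=
  (1 < #|[set i | (#|[set j | (Some j, i) \in J]%SET| < n)%N
                  & (None, i) \in J]%SET|)%N.
rewrite (_ : two_above n t = [set w | Q [set k | b k w]%SET]).
  apply: measurable_finite_tests => -[[j|] i]; first exact: measurable_outranks.
  rewrite -[X in measurable X]setTI.
  rewrite (_ : [set w | _] = (fun w => valuation w i) @^-1` `]t, +oo[)//.
    exact: measurable_valuation.
  by apply/seteqP; split => w /=; rewrite in_itv/= andbT.
rewrite /two_above; apply/funext => w; congr (is_true (_ < _)%N).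
apply: eq_card => i; rewrite !inE; congr ((_ < n)%N && _).
by apply: eq_card => j; rewrite !inE.
Qed.

End price_event.

(** * Effect of accuracy on the law of the price *)

Section accuracy.
Context (R : realType) (m : nat).
Local Open Scope ereal_scope.
Implicit Types (n : nat) (t : R) (w : m.-tuple (R * R)%type) (i : 'I_m).

Lemma tsubst_off w i (x y : (R * R)%type) j : j != i ->
  tnth (tsubst w i x) j = tnth (tsubst w i y) j.
Proof. by move=> ji; rewrite !tnth_tsubst. Qed.

Lemma admitted_tsubst_le n w i v v' s s' : (s <= s')%R ->
  i \in admitted n (tsubst w i (v, s)) ->
  i \in admitted n (tsubst w i (v', s')).
Proof.
move=> ss'; apply: admitted_signal_le; first exact: tsubst_off.
by rewrite /signal !tnth_tsubst_id.
Qed.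

Lemma two_above_tsubst_in n t w i v v' s s' : (v <= v')%R ->
  i \in admitted n (tsubst w i (v, s)) ->
  i \in admitted n (tsubst w i (v', s')) ->
  two_above n t (tsubst w i (v, s)) -> two_above n t (tsubst w i (v', s')).
Proof.
move=> vv' iw iw'; rewrite /two_above /=.
rewrite (@eq_admitted _ _ _ _ i (tsubst_off w (v, s) (v', s')) n); last first.
  by rewrite iw iw'.
move=> /leq_trans; apply; apply/subset_leq_card/fintype.subsetP => j.
rewrite !inE => /andP[-> /=]; rewrite /valuation.
have [->|ji] := eqVneq j i; last by rewrite (tsubst_off _ _ (v', s')).
by rewrite !tnth_tsubst_id => /lt_le_trans; exact.
Qed.

Lemma two_above_tsubst_notin n t w i v v' s s' :
  i \notin admitted n (tsubst w i (v, s)) ->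
  i \notin admitted n (tsubst w i (v', s')) ->
  two_above n t (tsubst w i (v, s)) -> two_above n t (tsubst w i (v', s')).
Proof.
move=> iw iw'; rewrite /two_above /=.
rewrite (@eq_admitted _ _ _ _ i (tsubst_off w (v, s) (v', s')) n); last first.
  by rewrite (negbTE iw) (negbTE iw').
move=> /leq_trans; apply; apply/subset_leq_card/fintype.subsetP => j.
rewrite finset.in_set => /andP[jA tv]; rewrite finset.in_set jA /=; move: tv.
have ji : j != i by apply: contraTneq jA => ->.
by rewrite /valuation (tsubst_off _ _ (v', s')).
Qed.

Lemma le_two_above (F F' : probability (R * R)%type R) n t :
  is_predictor F -> is_predictor F' -> more_accurate F F' ->
  iid_law F' m (two_above n t) <= iid_law F m (two_above n t).
Proof.
move=> pF pF' FF'; apply: le_iid_law; first exact: measurable_two_above.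
move=> w i.
(* The valuation 0 is a placeholder, since admission looks at signals only. *)
pose U := [set s | i \in admitted n (tsubst w i (0%R, s))].
apply: (@le_more_accurate _ _ _ U) => //.
- by apply: measurable_tsubst_section; exact: measurable_two_above.
- by move=> s s' ss' /=; exact: admitted_tsubst_le.
- move=> v v' s s' /= Us Us' vv'; apply: two_above_tsubst_in => //.
  + exact: admitted_tsubst_le Us.
  + exact: admitted_tsubst_le Us'.
- move=> v v' s s' /= Us Us'; apply: two_above_tsubst_notin => //; apply/negP.
  + by move=> H; apply: Us; exact: admitted_tsubst_le H.
  + by move=> H; apply: Us'; exact: admitted_tsubst_le H.
Qed.

Lemma eq_two_above_all (F F' : probability (R * R)%type R) t :
  is_predictor F -> is_predictor F' -> more_accurate F F' ->
  iid_law F m (two_above m t) = iid_law F' m (two_above m t).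
Proof.
move=> pF pF' FF'.
have sec (w : m.-tuple (R * R)%type) i :
    F' [set x | two_above m t (tsubst w i x)] =
    F [set x | two_above m t (tsubst w i x)].
  apply: eq_same_marginal => //.
    by apply: measurable_tsubst_section; exact: measurable_two_above.
  by move=> v v' s s' vv'; apply: two_above_tsubst_in => //;
    rewrite admitted_all inE.
by apply/eqP; rewrite eq_le; apply/andP; split; apply: le_iid_law;
  rewrite ?sec//; try exact: measurable_two_above; move=> w i; rewrite sec.
Qed.

End accuracy.

(** * Revenue as an integral of tail probabilities *)

Section revenue_comparison.
Context (R : realType) (m : nat).
Local Open Scope ereal_scope.
Implicit Types (n : nat) (t : R) (F : probability (R * R)%type R).

Definition price n (w : m.-tuple (R * R)%type) : R :=
  second_highest w (admitted n w).

Lemma price_gtE n t : (2 <= n <= m)%N ->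
  [set w | (t < price n w)%R] = two_above n t.
Proof.
move=> /andP[n2 nm]; apply/funext => w; congr is_true.
by apply: second_highest_gt; rewrite card_admitted.
Qed.

Lemma measurable_price n : (2 <= n <= m)%N -> measurable_fun setT (price n).
Proof.
move=> nm; apply: (measurability _ (RGenOInfty.measurableE R)) => //.
move=> _ [_ [t ->] <-]; rewrite setTI.
rewrite (_ : _ @^-1` _ = two_above n t); first exact: measurable_two_above.
by rewrite -price_gtE//; apply/seteqP; split => w /=; rewrite in_itv/= andbT.
Qed.

Lemma predictor_valuation_ge0 F : is_predictor F ->
  exists N, [/\ measurable N, iid_law F m N = 0 &
    forall w, ~ N w -> forall i, (0 <= valuation w i)%R].
Proof.
move=> [F1 _ _ _].
pose I2 : set (R * R) := `[0%R, 1%R]%classic `*` `[0%R, 1%R]%classic.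
pose A := [set w : m.-tuple (R * R)%type | forall i : 'I_m,
  (fun=> I2) i (tnth w i)].
have mI2 : measurable I2 by exact: measurableX.
have mA : measurable A.
  rewrite (_ : A = \bigcap_(i in [set: 'I_m])
      ((fun w => tnth w i) @^-1` I2)).
    apply: fin_bigcap_measurable => // i _.
    by rewrite -[X in measurable X]setTI; exact: measurable_tnth.
  by apply/seteqP; split => w h i; [move=> _|]; exact: h.
exists (~` A); split; first exact: measurableC.
  rewrite probability_setC// iid_law_rectangle//.
  by rewrite big1 ?subee// => i _.
by move=> w /contrapT Aw i; have [/=] := Aw i; rewrite in_itv/= => /andP[].
Qed.

Lemma price_ge0 n w : (forall i, (0 <= valuation w i)%R) -> (0 <= price n w)%R.
Proof.
move=> v0; rewrite /price /second_highest.
set s := sort _ _; have [s1|s1] := ltnP 1 (size s); last by rewrite nth_default.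
have := mem_nth 0%R s1; rewrite mem_sort => /mapP[i _ ->]; exact: v0.
Qed.

(** The tail formula needs a variable that is nonnegative everywhere, and the price is so only
    almost surely. It is therefore applied to the positive part, whose tail is that of the price for
    [t >= 0]. *)
Lemma revenue_ccdf n F : (2 <= n <= m)%N -> is_predictor F ->
  exists f : R -> \bar R, [/\ revenue_SP n F m =
      \int[lebesgue_measure]_(t in `[0%R, +oo[) f t, measurable_fun setT f &
    forall t, (0 <= t)%R -> f t = iid_law F m (two_above n t)].
Proof.
move=> nm pF; have mp := measurable_price nm.
pose X : {RV (iid_law F m) >-> R} := mfun_Sub (mem_set mp).
exists (@ccdf _ _ _ (iid_law F m) X^\+%R); split; last 2 first.
- exact: ccdf_measurable.
- move=> t t0; rewrite /ccdf /distribution /pushforward; congr (iid_law F m _).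
  rewrite -price_gtE//; apply/seteqP; split => w /=.
    by rewrite in_itv/= andbT /funrpos/= lt_max => /orP[//|]; rewrite ltNge t0.
  by rewrite in_itv/= andbT /funrpos/= lt_max => ->.
rewrite -ge0_expectation_ccdf; last by move=> w; exact: funrpos_ge0.
rewrite /revenue_SP unlock; apply: ae_eq_integral => //.
- exact/measurable_EFinP.
- exact/measurable_EFinP.
have [N [mN N0 v0]] := predictor_valuation_ge0 pF.
exists N; split => // w /= H; apply: contrapT => /v0 {}v0; apply: H => _.
by congr EFin; rewrite /funrpos /= max_l//; exact: price_ge0.
Qed.

Lemma le_revenue n n' (F F' : probability (R * R)%type R) :
  (2 <= n <= m)%N -> (2 <= n' <= m)%N -> is_predictor F -> is_predictor F' ->
  (forall t, iid_law F m (two_above n t) <= iid_law F' m (two_above n' t)) ->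
  revenue_SP n F m <= revenue_SP n' F' m.
Proof.
move=> nm n'm pF pF' le_two.
have [f [-> mf fE]] := revenue_ccdf nm pF.
have [f' [-> mf' f'E]] := revenue_ccdf n'm pF'.
have I0 t : `[0%R, +oo[%classic t -> (0 <= t)%R by rewrite /= in_itv/= andbT.
apply: ge0_le_integral => //.
- by move=> t /I0 /fE ->.
- exact: measurable_funTS.
- exact: measurable_funTS.
- by move=> t /I0 t0; rewrite fE// f'E.
Qed.

End revenue_comparison.

(** * Perfect prediction: almost sure concordance of valuations and signals *)

Section perfect_prediction.
Context (R : realType) (m : nat).
Local Open Scope ereal_scope.
Implicit Types (n : nat) (t : R) (w : m.-tuple (R * R)%type) (i k : 'I_m).

(** The lower-left quadrant has the mass of the smaller of the two half-planes that contain it, so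
    it exhausts that half-plane up to a null set. *)
Lemma perfect_quadrants (F : probability (R * R)%type R) (q r : R) :
  is_predictor F -> is_perfect F ->
  F (`]-oo, q] `*` `]r, +oo[) = 0 \/ F (`]q, +oo[ `*` `]-oo, r]) = 0.
Proof.
move=> pF perF; pose D1 := `]-oo, q]%classic : set R.
pose D2 := `]-oo, r]%classic : set R.
have D1le x y : (x <= y)%R -> D1 y -> D1 x.
  by rewrite /D1/= !in_itv/=; exact: le_trans.
have D2le x y : (x <= y)%R -> D2 y -> D2 x.
  by rewrite /D2/= !in_itv/=; exact: le_trans.
have mD1 := down_closed_measurable D1le.
have mD2 := down_closed_measurable D2le.
have [a [b [a01 b01 /(_ F pF)[F1 F2 F12]]]] := predictor_down_closed D1le D2le.
have fin A : measurable A -> F A < +oo.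
  by move=> mA; rewrite -ge0_fin_numE// fin_num_measure.
have FD A : measurable A -> D1 `*` D2 `<=` A ->
    F (A `\` D1 `*` D2) = F A - F (D1 `*` D2).
  move=> mA sub; rewrite measureD ?setIidr//; [exact: measurableX|exact: fin].
have F12E : F (D1 `*` D2) = Order.min (F (D1 `*` setT)) (F (setT `*` D2)).
  by rewrite F12 perF// F1 F2.
have [F1le|F2le] := leP (F (D1 `*` setT)) (F (setT `*` D2)).
  left; rewrite (_ : _ `*` _ = D1 `*` setT `\` D1 `*` D2).
    rewrite FD; [|exact: measurableX|by move=> -[x y] []].
    by rewrite F12E (min_idPl F1le) subee// fin_num_measure//;
      exact: measurableX.
  apply/seteqP; split => -[x y] /=; rewrite /D1/D2/= !in_itv/= andbT.
    by move=> [xq ry]; split=> // -[_]; rewrite leNgt ry.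
  by move=> [[xq _] H]; split=> //; rewrite ltNge; apply/negP => yr; exact: H.
right; rewrite (_ : _ `*` _ = setT `*` D2 `\` D1 `*` D2).
  rewrite FD; [|exact: measurableX|by move=> -[x y] []].
  by rewrite F12E (min_idPr (ltW F2le)) subee// fin_num_measure//;
    exact: measurableX.
apply/seteqP; split => -[x y] /=; rewrite /D1/D2/= !in_itv/= andbT.
  by move=> [qx yr]; split=> // -[]; rewrite leNgt qx.
by move=> [[_ yr] H]; split=> //; rewrite ltNge; apply/negP => xq; exact: H.
Qed.

Lemma iid_law_coordinate0 (F : probability (R * R)%type R) (A : set (R * R)) i :
  measurable A -> F A = 0 ->
  (iid_law F m).-negligible [set w | A (tnth w i)].
Proof.
move=> mA A0.
have mE : measurable [set w : m.-tuple (R * R)%type | A (tnth w i)].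
  by rewrite -[X in measurable X]setTI; exact: measurable_tnth.
apply/negligibleP => //; apply: (@iid_law0 _ _ _ _ _ _ i) => // w /=.
by under eq_set do rewrite tnth_tsubst_id.
Qed.

(** Rationals [q] and [r] separating a discordant pair put [k] and [i] in two opposite quadrants,
    one of which is null. There are countably many such rational pairs. *)
Lemma ae_concordant (F : probability (R * R)%type R) k i :
  is_predictor F -> is_perfect F ->
  \forall w \ae iid_law F m,
    (signal w i < signal w k)%R -> (valuation w i <= valuation w k)%R.
Proof.
move=> pF perF.
pose C (x : option (rat * rat)) (w : m.-tuple (R * R)%type) :=
  if x is Some (q, r) then
    ~ [/\ (valuation w k <= ratr q)%R, (ratr r < signal w k)%R,
          (ratr q < valuation w i)%R & (signal w i <= ratr r)%R]
  else True.
(* Rational pairs are enumerated through [unpickle], which is partial; this is why [C] takes an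
   option. *)
have aeC : \forall w \ae iid_law F m, forall j : nat, C (unpickle j) w.
  apply: ae_foralln => j; case: (unpickle j) => [[q r]|]; last first.
    by apply: nearW.
  have [F0|F0] := perfect_quadrants (ratr q) (ratr r) pF perF.
    apply: negligibleS (iid_law_coordinate0 k _ F0); last exact: measurableX.
    by move=> w /contrapT[vk sk _ _]; rewrite /= !in_itv/= andbT.
  apply: negligibleS (iid_law_coordinate0 i _ F0); last exact: measurableX.
  by move=> w /contrapT[_ _ vi si]; rewrite /= !in_itv/= andbT.
apply: filterS aeC => w Cw sik; rewrite leNgt; apply/negP => vki.
have [q] := rat_in_itvoo vki; rewrite in_itv/= => /andP[vq qv].
have [r] := rat_in_itvoo sik; rewrite in_itv/= => /andP[sr rs].
have := Cw (pickle (q, r)); rewrite pickleK /=; apply.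
by split=> //; exact: ltW.
Qed.

(** With all bidders but [i] fixed, the signal of [k] is a constant, which the atomless signal of
    [i] avoids almost surely. *)
Lemma ae_distinct_signals (F : probability (R * R)%type R) k i :
  is_predictor F -> k != i ->
  \forall w \ae iid_law F m, signal w i <> signal w k.
Proof.
move=> pF ki.
have mE : measurable [set w : m.-tuple (R * R)%type | signal w i == signal w k].
  have := measurable_fun_eqr (@measurable_signal R m i)
                             (@measurable_signal R m k).
  by move=> /(_ measurableT [set true]); rewrite setTI; exact.
have : (iid_law F m).-negligible
    [set w : m.-tuple (R * R)%type | signal w i == signal w k].
  apply/negligibleP => //; apply: (@iid_law0 _ _ _ _ _ _ i) => // w /=.
  rewrite -(predictor_snd_atomless (signal w k) pF); congr (F _).
  apply/seteqP; split => -[x y] /=;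
    rewrite /signal tnth_tsubst_id tnth_tsubst//=.
    by move=> /eqP.
  by case=> _ ->.
by apply: negligibleS => w /contrapT /eqP.
Qed.

Lemma two_above_concordant n t w : (2 <= n <= m)%N ->
  (forall k i, (signal w i < signal w k)%R ->
    (valuation w i <= valuation w k)%R) ->
  (forall k i, k != i -> signal w i <> signal w k) ->
  two_above m t w -> two_above n t w.
Proof.
move=> /andP[n2 nm] conc dist; rewrite /two_above/= admitted_all => two.
have [sub|] := boolP
    ([set i in [set: 'I_m] | (t < valuation w i)%R] \subset admitted n w)%SET.
  apply: (leq_trans two); apply/subset_leq_card/fintype.subsetP => i iX.
  rewrite finset.in_set (fintype.subsetP sub)//.
  by move: iX; rewrite !finset.in_set.
move=> /fintype.subsetPn[i]; rewrite finset.in_set finset.in_setT /= => ti iA.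
apply: (leq_trans n2); rewrite -[leqLHS](card_admitted w nm).
apply/subset_leq_card/fintype.subsetP => k kA.
rewrite finset.in_set kA /=; apply: (lt_le_trans ti); apply: conc.
have ki : k != i by apply: contraNneq iA => <-.
(* Distinct signals exclude the tie-break, leaving the strict inequality that [conc] requires. *)
have := unadmitted_outranked iA kA.
rewrite /outranks => /orP[//|/andP[/eqP sik]].
by have := dist k i ki.
Qed.

Lemma sub_two_above n n' t :
  (n <= n')%N -> @two_above R m n t `<=` two_above n' t.
Proof.
move=> nn' w; rewrite /two_above /= => /leq_trans; apply.
apply/subset_leq_card/fintype.subsetP => i; rewrite !(finset.in_set, inE).
by move=> /andP[/leq_trans -> //].
Qed.

Lemma perfect_two_above (F : probability (R * R)%type R) n t :
  is_predictor F -> is_perfect F -> (2 <= n <= m)%N ->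
  iid_law F m (two_above n t) = iid_law F m (two_above m t).
Proof.
move=> pF perF nm.
(* Packing both indices into a pair turns the claim into one finite intersection of almost sure
   events. *)
have conc : \forall w \ae iid_law F m, forall ki : 'I_m * 'I_m,
    (signal w ki.2 < signal w ki.1)%R ->
    (valuation w ki.2 <= valuation w ki.1)%R.
  by apply: filter_forall => -[k i]; exact: ae_concordant.
have dist : \forall w \ae iid_law F m, forall ki : 'I_m * 'I_m,
    ki.1 != ki.2 -> signal w ki.2 <> signal w ki.1.
  apply: filter_forall => -[k i] /=.
  have [->|ki] := eqVneq k i; first by apply: nearW.
  by apply: filterS (ae_distinct_signals pF ki).
have [N [mN N0 sub]] := filterI conc dist.
apply: (eq_measure_off_null _ _ mN N0); try exact: measurable_two_above.
move=> w Nw; have /contrapT[/= {}conc {}dist] := contra_not (sub w) Nw.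
split; last first.
  by apply: two_above_concordant => // k i;
    [exact: (conc (k, i))|exact: (dist (k, i))].
by apply: sub_two_above; case/andP: nm.
Qed.

End perfect_prediction.

Local Open Scope ereal_scope.

Theorem theorem2 (R : realType) (m : nat) (hm : (2 <= m)%N) :
  [/\
    (* (i) *)
    (forall F : probability (R * R)%type R, is_predictor F ->
      (forall n n' : nat, (2 <= n)%N -> (n <= n')%N -> (n' <= m)%N ->
        revenue_SP n F m <= revenue_SP n' F m) /\
      (forall n : nat, (2 <= n)%N -> (n <= m)%N ->
        revenue_SP n F m <= revenue_SP m F m)),
    (* (ii), monotonicity in accuracy *)
    (forall n : nat, (2 <= n)%N -> (n <= m)%N ->
      forall F F' : probability (R * R)%type R,
        is_predictor F -> is_predictor F' -> more_accurate F F' ->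
        revenue_loss n F m <= revenue_loss n F' m) &
    (* (ii), perfect predictor *)
    (forall F : probability (R * R)%type R, is_predictor F -> is_perfect F ->
      forall n n' : nat, (2 <= n)%N -> (n <= m)%N -> (2 <= n')%N ->
        (n' <= m)%N -> revenue_SP n F m = revenue_SP n' F m)].
Proof.
have mono (F : probability (R * R)%type R) : is_predictor F -> forall n n' : nat,
    (2 <= n)%N -> (n <= n')%N -> (n' <= m)%N ->
    revenue_SP n F m <= revenue_SP n' F m.
  move=> pF n n' n2 nn' n'm; apply: le_revenue => //.
  - by rewrite n2 (leq_trans nn' n'm).
  - by rewrite n'm (leq_trans n2 nn').
  move=> t; apply: le_measure; rewrite ?inE; try exact: measurable_two_above.
  exact: sub_two_above.
split.
- move=> F pF; split=> [|n n2 nm]; [|apply: (mono F pF n)] => //.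
  exact: mono.
(* Full admission earns the same under both predictors, while the subtracted revenue is at least as
   large under [F]. *)
- move=> n n2 nm F F' pF pF' FF'; apply: leeB.
    apply: le_revenue; rewrite ?hm ?leqnn// => t.
    by rewrite (eq_two_above_all _ _ pF pF').
  by apply: le_revenue; rewrite ?n2// => t; exact: le_two_above.
- move=> F pF perF n n' n2 nm n2' nm'.
  by apply/eqP; rewrite eq_le; apply/andP; split; apply: le_revenue => //;
    rewrite ?n2 ?n2'// => t; rewrite !perfect_two_above ?n2 ?n2'.
Qed.
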